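(* Let $k>m+2$. The projective shape space $P\Sigma_m^k=G(k,m)/PGL(m)$ is a manifold diffeomorphic with $(\mathbb{R}P^m)^q$, where $q=k-m-2$.
   Context: $\mathbb{R}P^m$ is the real projective space in $m$ dimensions, i.e. the set of axes $[X]=\{\lambda X:\lambda\neq0\}$, $X\in\mathbb{R}^{m+1}\setminus\{0\}$, going through the origin of $\mathbb{R}^{m+1}$. $PGL(m)$ is the group of projective transformations of $\mathbb{R}P^m$, i.e. maps $\alpha$ given by $\alpha([X])=[AX]$ with $A\in GL(m+1,\mathbb{R})$. A linear variety of dimension $d$ in $\mathbb{R}P^m$ is a set $\{[x]:x\in V\setminus\{0\}\}$, where $V$ is a $(d+1)$-dimensional vector subspace of $\mathbb{R}^{m+1}$. The linear span of a subset of $\mathbb{R}P^m$ is the smallest linear variety containing that subset. A system of at least $m+2$ points in $\mathbb{R}P^m$ is in general position if its linear span is $\mathbb{R}P^m$. A projective frame in $\mathbb{R}P^m$ is an ordered system of $m+2$ points in general position. For $k>m+2$, $G(k,m)$ denotes the set of all ordered systems $(p_1,\dots,p_k)$ of $k$ points of $\mathbb{R}P^m$ for which $(p_1,\dots,p_{m+2})$ is a projective frame. The group $PGL(m)$ acts on $G(k,m)$ by $\alpha(p_1,\dots,p_k)=(\alpha p_1,\dots,\alpha p_k)$. The projective shape space $P\Sigma_m^k$, or space of projective $k$-ads in $\mathbb{R}P^m$, is the quotient $G(k,m)/PGL(m)$.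
   Formalization: General position is taken to mean that every m+1 points of the system span RP^m, not only that the whole system does; with the literal definition the quotient is not T1 (m=1, k=4: the orbit of (a,a,b,x) accumulates at (a,a,b,b)). *)

(* Defs.v *)
From HB Require Import structures.
From mathcomp Require Import all_boot all_order all_algebra.
From mathcomp Require Import all_classical all_reals all_analysis.

Set Implicit Arguments.
Unset Strict Implicit.
Unset Printing Implicit Defensive.

Import Order.TTheory GRing.Theory Num.Theory.
Import numFieldNormedType.Exports.

Local Open Scope classical_set_scope.
Local Open Scope ring_scope.
Local Open Scope quotient_scope.

Section Smooth.
Context {R : realType}.

(* [V] and [W] are meant to be finite-dimensional and [U] open: [f] is C^(k+1) iff it is
   differentiable and x |-> df_x(v) is C^k for every v, and the values of
   ['d f x] for x in [U] only depend on the restriction of [f] to [U]. *)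
Fixpoint Ck (V W : normedModType R) (k : nat) (U : set V) (f : V -> W) : Prop :=
  match k with
  | 0 => forall x, U x -> {for x, continuous f}
  | k'.+1 => (forall x, U x -> differentiable f x) /\
             (forall v, Ck k' U (fun x => 'd f x v))
  end.

Definition smooth_on (V W : normedModType R) (U : set V) (f : V -> W) : Prop :=
  forall k, Ck k U f.

(* The values of [cmap] outside [cdom] are irrelevant. *)
Record chart (M : topologicalType) (V : normedModType R) :=
  Chart { cdom : set M ; cmap :> M -> V }.

(* A homeomorphism from an open set onto an open set. *)
Definition is_chart (M : topologicalType) (V : normedModType R)
    (c : chart M V) : Prop :=
  [/\ open (cdom c),
      forall x y, cdom c x -> cdom c y -> c x = c y -> x = y,
      forall x, cdom c x -> {for x, continuous c}
    & forall O, open O -> O `<=` cdom c -> open (c @` O)].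

Definition atlas (M : topologicalType) (V : normedModType R) : Type :=
  set (chart M V).

(* [g] is d o f o c^-1 on its natural domain c (dom c /\ f^-1 (dom d)), and it is
   smooth there; taking [f] to be the identity gives the transition maps. *)
Definition smooth_rep (M N : topologicalType) (V W : normedModType R)
    (c : chart M V) (d : chart N W) (f : M -> N) (g : V -> W) : Prop :=
  smooth_on (c @` (cdom c `&` f @^-1` cdom d)) g /\
  (forall x, cdom c x -> cdom d (f x) -> g (c x) = d (f x)).

Definition smooth_atlas (M : topologicalType) (V : normedModType R)
    (A : atlas M V) : Prop :=
  [/\ hausdorff_space M,
      @second_countable M,
      forall c, A c -> is_chart c,
      forall x, exists2 c, A c & cdom c x
    & forall c d, A c -> A d -> exists g, smooth_rep c d id g].

Definition smooth_map (M N : topologicalType) (V W : normedModType R)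
    (A : atlas M V) (B : atlas N W) (f : M -> N) : Prop :=
  continuous f /\
  (forall c d, A c -> B d -> exists g, smooth_rep c d f g).

Definition diffeomorphism (M N : topologicalType) (V W : normedModType R)
    (A : atlas M V) (B : atlas N W) (f : M -> N) : Prop :=
  smooth_map A B f /\
  (exists g : N -> M, [/\ cancel f g, cancel g f & smooth_map B A g]).

Definition diffeomorphic (M N : topologicalType) (V W : normedModType R)
    (A : atlas M V) (B : atlas N W) : Prop :=
  exists f : M -> N, diffeomorphism A B f.

Definition submersion (M N : topologicalType) (V W : normedModType R)
    (A : atlas M V) (B : atlas N W) (f : M -> N) : Prop :=
  smooth_map A B f /\
  (forall c d g, A c -> B d -> smooth_rep c d f g ->
   forall x, cdom c x -> cdom d (f x) ->
   forall w : W, exists v : V, 'd g (c x) v = w).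

(* The smooth structure of an open subset [S] of a manifold. *)
Definition sub_chart (M : topologicalType) (V : normedModType R) (S : set M)
    (c : chart M V) : chart S V :=
  @Chart S V (set_val @^-1` cdom c) (c \o set_val).

Definition sub_atlas (M : topologicalType) (V : normedModType R) (S : set M)
    (A : atlas M V) : atlas S V :=
  [set sub_chart S c | c in A].

(* The smooth structure of the power [M ^ n] of an [m]-dimensional manifold. *)
Definition power_chart (M : topologicalType) (m n : nat)
    (c : 'I_n -> chart M 'rV[R]_m) : chart {ptws 'I_n -> M} 'M[R]_(n, m) :=
  @Chart {ptws 'I_n -> M} 'M[R]_(n, m)
    [set p | forall i, cdom (c i) (p i)]
    (fun p => \matrix_(i, j) c i (p i) 0 j).

Definition power_atlas (M : topologicalType) (m n : nat)
    (A : atlas M 'rV[R]_m) : atlas {ptws 'I_n -> M} 'M[R]_(n, m) :=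
  [set power_chart c | c in [set c | forall i, A (c i)]].

End Smooth.

Arguments sub_atlas {R M V} S A.
Arguments power_atlas {R M m} n A.

Section ProjectiveSpace.
Variables (R : realType) (m : nat).

Definition nzvec : set 'cV[R]_m.+1 := [set X | X != 0].

Definition NZ (X : 'cV[R]_m.+1) (X0 : X != 0) : nzvec := exist _ X (mem_set X0).

Lemma nzvecP (X : nzvec) : val X != 0.
Proof. exact: set_valP X. Qed.

Definition same_axis : rel nzvec :=
  fun X Y => `[< exists2 l : R, l != 0 & val Y = l *: val X >].

Lemma same_axis_equiv : equiv_class_of same_axis.
Proof.
split=> [X|X Y|Y X Z].
- by apply/asboolP; exists 1; rewrite ?oner_eq0// scale1r.
- apply/asboolP/asboolP => -[l l0 e]; exists l^-1; rewrite ?invr_eq0//.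
  + by rewrite e scalerA mulVf// scale1r.
  + by rewrite e scalerA mulVf// scale1r.
- move=> /asboolP[l l0 e] /asboolP[l' l0' e']; apply/asboolP.
  by exists (l' * l); rewrite ?mulf_neq0// e' e scalerA.
Qed.

Canonical same_axis_equiv_rel := EquivRelPack same_axis_equiv.

Definition RP : topologicalType := quotient_topology {eq_quot same_axis}.

Definition axis (X : nzvec) : RP := \pi_(quotient_topology {eq_quot same_axis}) X.

Lemma axisP (X Y : nzvec) :
  axis X = axis Y <-> exists2 l : R, l != 0 & val Y = l *: val X.
Proof.
split=> [e|h].
  by have /eqmodP/asboolP : X = Y %[mod {eq_quot same_axis}] := e.
by apply: (eqmodP same_axis_equiv_rel X Y _); apply/asboolP.
Qed.

Lemma axis_surj (p : RP) : exists X, p = axis X.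
Proof. by exists (repr p); rewrite /axis reprK. Qed.

(* The affine chart [X_0 : ... : X_m] |-> (X_j / X_i)_(j <> i), defined where
   X_i <> 0; neither depends on the representative, see [affine_chart_axis]. *)
Definition affine_chart (i : 'I_m.+1) : chart RP 'rV[R]_m :=
  @Chart R RP 'rV[R]_m
    [set axis X | X in [set X : nzvec | val X i 0 != 0]]
    (fun p : RP => let X := val (repr p : nzvec) in
       \row_j (X (lift i j) 0 / X i 0)).

Definition RP_atlas : atlas RP 'rV[R]_m := range affine_chart.

Lemma affine_chart_axis (i : 'I_m.+1) (X : nzvec) :
  (cdom (affine_chart i) (axis X) <-> val X i 0 != 0) /\
  affine_chart i (axis X) = \row_j (val X (lift i j) 0 / val X i 0).
Proof.
split.
  split=> [[Y /= Yi /axisP[l l0 ->]]|Xi]; first by rewrite mxE mulf_neq0.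
  by exists X.
rewrite /affine_chart /=; apply/rowP => j; rewrite !mxE.
have /axisP[l l0 ->] : axis (repr (axis X)) = axis X by rewrite /axis reprK.
by rewrite !mxE -mulf_div divff// mul1r.
Qed.

(* A vector subspace of dimension d + 1 gives a linear variety of dimension d. *)
Definition linear_variety (d : nat) (S : set RP) : Prop :=
  exists2 V : {vspace 'cV[R]_m.+1}, \dim V = d.+1 &
    S = [set axis X | X in [set X : nzvec | val X \in V]].

Definition linear_span (D : set RP) : set RP :=
  smallest [set S | exists d, linear_variety d S] D.

(* Every m + 1 of the points span RP^m. Asking this only of the whole system would
   be too weak: with m = 1 and k = 4, the tuples (a, a, b, x) with a <> b would then
   be admitted; the orbit of one with x <> a, b accumulates at (a, a, b, b), so
   the quotient by PGL(m) would not be T1. *)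
Definition general_position (n : nat) (p : 'I_n -> RP) : Prop :=
  (m.+2 <= n)%N /\
  (forall f : 'I_m.+1 -> 'I_n, injective f -> linear_span (range (p \o f)) = setT).

Definition projective_frame (p : 'I_m.+2 -> RP) : Prop := general_position p.

Lemma unitmx_nz (A : 'M[R]_m.+1) (X : nzvec) :
  A \in unitmx -> A *m val X != 0.
Proof.
move=> uA; apply: contra (nzvecP X) => /eqP e.
by rewrite -(mulKmx uA (val X)) e mulmx0.
Qed.

Definition PGL : set (RP -> RP) :=
  [set al | exists (A : 'M[R]_m.+1) (uA : A \in unitmx),
     forall X, al (axis X) = axis (NZ (unitmx_nz X uA))].

Lemma PGL_id : PGL id.
Proof.
exists 1%:M, (unitmx1 _ _) => X; apply/axisP; exists 1; first exact: oner_neq0.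
by rewrite /= mul1mx scale1r.
Qed.

Lemma PGL_comp (al be : RP -> RP) : PGL al -> PGL be -> PGL (be \o al).
Proof.
move=> [A [uA eA]] [B [uB eB]].
have uBA : B *m A \in unitmx by rewrite unitmx_mul uB.
exists (B *m A), uBA => X; rewrite /= eA eB; apply/axisP.
by exists 1; rewrite ?oner_neq0// scale1r /= mulmxA.
Qed.

Lemma PGL_inv (al : RP -> RP) : PGL al -> exists2 be, PGL be & cancel al be.
Proof.
move=> [A [uA eA]].
have uV : invmx A \in unitmx by rewrite unitmx_inv.
pose be (p : RP) := axis (NZ (unitmx_nz (repr p : nzvec) uV)).
have beE X : be (axis X) = axis (NZ (unitmx_nz X uV)).
  have /axisP[l l0 e] : axis (repr (axis X)) = axis X by rewrite /axis reprK.
  by apply/axisP; exists l; rewrite //= e -scalemxAr.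
exists be; first by exists (invmx A), uV.
move=> p; have [X ->] := axis_surj p; rewrite eA beE; apply/axisP.
by exists 1; rewrite ?oner_neq0// scale1r /= mulKmx.
Qed.

End ProjectiveSpace.

Arguments RP_atlas R m : clear implicits.

Section ProjectiveShape.
Variables (R : realType) (m k : nat) (hk : (m.+2 < k)%N).

Definition first_points (p : 'I_k -> RP R m) : 'I_m.+2 -> RP R m :=
  p \o widen_ord (ltnW hk).

Definition Gkm : set {ptws 'I_k -> RP R m} :=
  [set p | projective_frame (first_points p)].

Definition same_shape : rel Gkm :=
  fun p p' => `[< exists2 al, PGL al & forall i, val p' i = al (val p i) >].

Lemma same_shape_equiv : equiv_class_of same_shape.
Proof.
have sym p p' : same_shape p p' -> same_shape p' p.
  move=> /asboolP[al /PGL_inv[be Pbe bK] e]; apply/asboolP.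
  by exists be => // i; rewrite e bK.
split=> [p|p p'|p' p p''].
- by apply/asboolP; exists id; [exact: PGL_id|].
- by apply/idP/idP => /sym.
- move=> /asboolP[al Pal e] /asboolP[be Pbe e']; apply/asboolP.
  by exists (be \o al); [exact: PGL_comp|move=> i; rewrite e' e].
Qed.

Canonical same_shape_equiv_rel := EquivRelPack same_shape_equiv.

Definition shape_space : topologicalType :=
  quotient_topology {eq_quot same_shape}.

Definition shape_of (p : Gkm) : shape_space :=
  \pi_(quotient_topology {eq_quot same_shape}) p.

Definition G_atlas : atlas Gkm 'M[R]_(k, m) :=
  sub_atlas Gkm (power_atlas k (RP_atlas R m)).

End ProjectiveShape.

Arguments Gkm R {m k} hk.
Arguments shape_space R {m k} hk.
Arguments shape_of R {m k} hk p.
Arguments G_atlas R {m k} hk.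

(* Main.v *)
Require Import Defs.
From mathcomp Require Import all_boot all_order all_algebra.
From mathcomp Require Import all_classical all_reals all_analysis.

Set Implicit Arguments.
Unset Strict Implicit.
Unset Printing Implicit Defensive.

Import Order.TTheory GRing.Theory Num.Theory.
Import numFieldNormedType.Exports.

Local Open Scope classical_set_scope.
Local Open Scope ring_scope.
Local Open Scope quotient_scope.

(** A projective frame is moved to the standard frame e_0, ..., e_m, e_0 + ... + e_m by
    exactly one projective transformation. Hence every orbit in G(k,m) contains exactly one
    k-ad [std_ad y] that starts with the standard frame, and the remaining q points
    y of (RP^m)^q are a complete invariant of the shape. Existence of the normal form is
    [frame_coordP], uniqueness comes from [fixes_std_frame].

    The invariant is explicit. Let the columns of B represent the first m + 1 points of the
    frame and let U represent the last one. The normalizing transformation sends the axis of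
    Y to the point with homogeneous coordinates (B^-1 Y)_i / (B^-1 U)_i, whose denominators
    do not vanish because the points are in general position. Replacing B^-1 by the adjugate
    and clearing denominators turns these coordinates into polynomials in the entries of
    representatives ([frame_coord]). So the bijection [shape_pts] from the shape space onto
    (RP^m)^q is continuous; its inverse is the class of [std_ad y] and is continuous too.
    The smooth structure of (RP^m)^q is transported along this homeomorphism, and then
    [shape_pts] is a diffeomorphism by construction.

    What remains is analysis in affine charts. Every map that occurs there has the form:
    homogeneous coordinates depending polynomially on a parameter, followed by division by
    a nonzero coordinate ([smooth_coord_mx]). This covers the transition maps of (RP^m)^q and
    the quotient map. The quotient map is a submersion because it has smooth local sections
    through every k-ad p ([shape_local_section]): keep the frame of p and let the other
    points follow the prescribed invariant; the chain rule then gives a preimage of every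
    tangent vector. *)

(** * Smooth maps *)

Lemma near_eq_continuous_at (S T : topologicalType) (f g : S -> T) (x : S) :
  (\forall y \near x, f y = g y) -> {for x, continuous f} -> {for x, continuous g}.
Proof.
move=> fg cf A; rewrite -(nbhs_singleton fg) => /cf.
by apply: filterS2 fg => y /= ->.
Qed.

Section Calculus.
Variables (R : realType) (V W : normedModType R).
Implicit Types (U : set V) (k : nat).

Lemma near_eq_diff (f g : V -> W) (x : V) :
  (\forall y \near x, f y = g y) -> differentiable f x ->
  differentiable g x /\ 'd g x = 'd f x :> (V -> W).
Proof.
move=> fg df; have [cf /eqaddoP ef] := (diff_locallyP _ _).1 df.
have gE : g \o shift x = cst (g x) + 'd f x +o_ 0 id.
  apply/eqaddoP => e e0; rewrite -(nbhs_singleton fg).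
  have : \forall h \near (0 : V), f (shift x h) = g (shift x h).
    have cs : {for (0 : V), continuous (shift x : V -> V)}.
      by apply: continuousD; [exact: cvg_id|exact: cvg_cst].
    by apply: (cs [set y | f y = g y]); rewrite /= add0r.
  apply: filterS2 (ef e e0) => h + E.
  by rewrite /= !fctE /= in E *; rewrite E.
have dg := diff_unique cf gE.
by split; [apply/diff_locallyP; rewrite dg; split|exact: dg].
Qed.

(** On an open set an equality of maps is an equality of germs at each point, so it passes to
    the derivatives of all orders. *)
Lemma Ck_ext k U (f g : V -> W) : open U -> (forall x, U x -> f x = g x) ->
  Ck k U f -> Ck k U g.
Proof.
move=> oU; elim: k f g => [|k IH] f g fg /=.
  move=> cf x Ux; apply: near_eq_continuous_at (cf x Ux).
  by apply: filterS (open_nbhs_nbhs (conj oU Ux)) => y /fg.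
move=> [df cf]; have D x : U x -> differentiable g x /\ 'd g x = 'd f x :> (V -> W).
  move=> Ux; apply: near_eq_diff (df _ Ux).
  by apply: filterS (open_nbhs_nbhs (conj oU Ux)) => y /fg.
split=> [x /D[dg _]|v]; [exact: dg|apply: IH (cf v) => x /D[_ e]].
by rewrite e.
Qed.

Lemma Ck_subset k U U' (f : V -> W) : U `<=` U' -> Ck k U' f -> Ck k U f.
Proof.
move=> UU'; elim: k f => [|k IH] f /=; first by move=> cf x /UU'/cf.
by move=> [df cf]; split=> [x /UU'/df//|v]; apply: IH.
Qed.

Lemma CkW k U (f : V -> W) : Ck k.+1 U f -> Ck k U f.
Proof.
elim: k f => [|k IH] f; first by move=> [df _] x /df/differentiable_continuous.
by move=> [df cf]; split=> // v; exact/IH/cf.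
Qed.

Lemma Ck_cst k U (a : W) : Ck k U (fun=> a).
Proof.
elim: k a => [|k IH] a /=; first by move=> x _; exact: cvg_cst.
split=> [x _|v]; first exact: differentiable_cst.
rewrite (_ : (fun x => _) = fun=> 0)//; apply/funext => x.
by have /(congr1 (fun h => h v)) /= := diff_cst a x.
Qed.

Lemma CkD k U (f g : V -> W) : open U ->
  Ck k U f -> Ck k U g -> Ck k U (fun x => f x + g x).
Proof.
move=> oU; elim: k f g => [|k IH] f g /=.
  by move=> cf cg x Ux; apply: cvgD; [exact: cf|exact: cg].
move=> [df cf] [dg cg]; split=> [x Ux|v].
  by apply: differentiableD; [exact: df|exact: dg].
apply: Ck_ext (IH _ _ (cf v) (cg v)) => // x Ux.
by have /(congr1 (fun h => h v)) /= := diffD (df x Ux) (dg x Ux).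
Qed.

Lemma Ck_sum (I : Type) (r : seq I) (P : pred I) k U (f : I -> V -> W) :
  open U -> (forall i, P i -> Ck k U (f i)) ->
  Ck k U (fun x => \sum_(i <- r | P i) f i x).
Proof.
move=> oU cf; elim: r => [|i r IH].
  by rewrite (_ : (fun x => _) = fun=> 0); [exact: Ck_cst|apply/funext => x; rewrite big_nil].
case Pi: (P i); last first.
  by under eq_fun do rewrite big_cons Pi.
by under eq_fun do rewrite big_cons Pi; apply: CkD => //; exact: cf.
Qed.

End Calculus.

Section SmoothFunctions.
Variables (R : realType) (V : normedModType R).
Implicit Types (U : set V) (k : nat).

Lemma CkM k U (f g : V -> R) : open U ->
  Ck k U f -> Ck k U g -> Ck k U (fun x => f x * g x).
Proof.
move=> oU; elim: k f g => [|k IH] f g.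
  by move=> cf cg x Ux; apply: cvgM; [exact: cf|exact: cg].
move=> Cf Cg; have cf0 := CkW Cf; have cg0 := CkW Cg.
move: Cf Cg => [df cf] [dg cg]; split=> [x Ux|v].
  by apply: differentiableM; [exact: df|exact: dg].
have := CkD oU (IH _ _ cf0 (cg v)) (IH _ _ cg0 (cf v)); apply: Ck_ext => // x Ux.
exact: esym (congr1 (fun h : V -> R => h v) (diffM (df x Ux) (dg x Ux))).
Qed.

(** The derivative of 1/f is -(1/f)^2 df: it involves no other inverse than 1/f itself, so
    the regularity of 1/f increases by one with each step of the induction. *)
Lemma CkV k U (f : V -> R) : open U -> (forall x, U x -> f x != 0) ->
  Ck k U f -> Ck k U (fun x => (f x)^-1).
Proof.
move=> oU f0; elim: k => [|k IH].
  by move=> cf x Ux; apply: cvgV; [exact: f0|exact: cf].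
move=> Cf; have cV := IH (CkW Cf); move: Cf => [df cf]; split=> [x Ux|v].
  by apply: differentiableV; [exact: df|exact: f0].
have := CkM oU (CkM oU cV cV) (CkM oU (Ck_cst k U (- 1 : R)) (cf v)).
apply: Ck_ext => // x Ux.
transitivity (- (f x) ^- 2 * 'd f x v).
  by rewrite mulN1r mulrN mulNr -invfM -expr2.
exact: esym (congr1 (fun h : V -> R => h v) (diffV (df x Ux) (f0 x Ux))).
Qed.

Lemma CkZl (W : normedModType R) k U (f : V -> R) (a : W) : open U ->
  Ck k U f -> Ck k U (fun x => f x *: a).
Proof.
move=> oU; elim: k f => [|k IH] f.
  by move=> cf x Ux; apply: cvgZr_tmp; exact: cf.
move=> [df cf]; split=> [x Ux|v]; first by apply: differentiableZl; exact: df.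
apply: Ck_ext (IH _ (cf v)) => // x Ux.
by have /(congr1 (fun h => h v)) /= -> := diffZl a (df x Ux).
Qed.

End SmoothFunctions.

Section SmoothMatrices.
Variables (R : realType).

Lemma smooth_entry n m (U : set 'M[R]_(n, m)) i j :
  smooth_on U (fun M : 'M[R]_(n, m) => M i j : R).
Proof.
case=> [|k]; first by move=> x _; exact: coord_continuous.
split=> [x _|v]; first exact: differentiable_coord.
rewrite (_ : (fun x => _) = fun=> v i j); first exact: Ck_cst.
apply/funext => x.
have @f : {linear 'M[R]_(n, m) -> R}.
  by exists (fun N : 'M[R]_(_, _) => N i j); do 2![eexists]; do ?[constructor];
     rewrite ?mxE// => ? *; rewrite ?mxE//; move=> ?; rewrite !mxE.
have /(congr1 (fun h => h v)) := @diff_lin _ _ _ f x (@coord_continuous _ _ _ i j).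
by [].
Qed.

Lemma smooth_matrix (V : normedModType R) n m (U : set V)
    (F : V -> 'M[R]_(n, m)) : open U ->
  (forall i j, smooth_on U (fun x => F x i j : R)) -> smooth_on U F.
Proof.
move=> oU sF k.
rewrite (_ : F = fun x => \sum_i \sum_j F x i j *: delta_mx i j); last first.
  by apply/funext => x; exact: matrix_sum_delta.
apply: Ck_sum => // i _; apply: Ck_sum => // j _; apply: CkZl => //; exact: sF.
Qed.

Lemma smooth_prod (V : normedModType R) (I : Type) (r : seq I) (P : pred I)
    (U : set V) (f : I -> V -> R) :
  open U -> (forall i, P i -> smooth_on U (f i)) ->
  smooth_on U (fun x => \prod_(i <- r | P i) f i x).
Proof.
move=> oU cf k; elim: r => [|i r IH].
  by under eq_fun do rewrite big_nil; exact: Ck_cst.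
case Pi: (P i); last by under eq_fun do rewrite big_cons Pi.
by under eq_fun do rewrite big_cons Pi; apply: CkM => //; exact: cf.
Qed.

Lemma smooth_det (V : normedModType R) n (U : set V) (F : V -> 'M[R]_n) :
  open U -> (forall i j, smooth_on U (fun x => F x i j : R)) ->
  smooth_on U (fun x => \det (F x) : R).
Proof.
move=> oU sF k; rewrite /determinant; apply: Ck_sum => // s _.
by apply: CkM => //; [exact: Ck_cst|apply: smooth_prod => // i _; exact: sF].
Qed.

Lemma smooth_adj (V : normedModType R) n (U : set V) (F : V -> 'M[R]_n) :
  open U -> (forall i j, smooth_on U (fun x => F x i j : R)) ->
  forall i j, smooth_on U (fun x => (\adj (F x)) i j : R).
Proof.
move=> oU sF i j k; under eq_fun do rewrite mxE /cofactor.
apply: CkM => //; first exact: Ck_cst.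
by apply: smooth_det => // a b l; under eq_fun do rewrite !mxE; exact: sF.
Qed.

Lemma smooth_trmx (V : normedModType R) n m (U : set V) (F : V -> 'M[R]_(n, m)) :
  (forall i j, smooth_on U (fun x => F x i j : R)) ->
  forall i j, smooth_on U (fun x => (F x)^T i j : R).
Proof. by move=> sF i j k; under eq_fun do rewrite mxE; exact: sF. Qed.

Lemma smooth_mulmx (V : normedModType R) n m p (U : set V)
    (F : V -> 'M[R]_(n, m)) (H : V -> 'M[R]_(m, p)) :
  open U -> (forall i j, smooth_on U (fun x => F x i j : R)) ->
  (forall i j, smooth_on U (fun x => H x i j : R)) ->
  forall i j, smooth_on U (fun x => (F x *m H x) i j : R).
Proof.
move=> oU sF sH i j k; under eq_fun do rewrite mxE.
by apply: Ck_sum => // l _; apply: CkM => //; [exact: sF|exact: sH].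
Qed.

End SmoothMatrices.

(** * Topological preliminaries *)

Section Pointwise.
Variables (I : finType) (M : topologicalType).

Lemma ptws_eval_continuous i : continuous (fun p : {ptws I -> M} => p i).
Proof. exact: (@proj_continuous I (fun=> M) i). Qed.

Lemma ptws_continuous_at (Z : topologicalType) (f : Z -> {ptws I -> M}) z :
  (forall i, {for z, continuous (fun x => f x i)}) -> {for z, continuous f}.
Proof.
move=> cf; apply/cvg_sup => i U [_ [[W oW <-] /= Wz WU]].
apply: (@filterS _ _ _ ((fun x => f x i) @^-1` W)); first by move=> x /WU.
by apply: cf; exact: open_nbhs_nbhs.
Qed.

Lemma ptws_open_box (D : I -> set M) : (forall i, open (D i)) ->
  open [set p : {ptws I -> M} | forall i, D i (p i)].
Proof.
move=> oD; rewrite openE => p Dp.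
suff : \forall q \near p, forall i : I, D i (q i) by [].
apply: (@filter_forall _ I (fun i (q : {ptws I -> M}) => D i (q i)) (nbhs p)) => i.
by apply: (@ptws_eval_continuous i p); apply: open_nbhs_nbhs.
Qed.

Lemma ptws_hausdorff : hausdorff_space M -> hausdorff_space {ptws I -> M}.
Proof. by move=> hM; exact: (@hausdorff_product I (fun=> M)). Qed.

End Pointwise.

Lemma injective_hausdorff (M N : topologicalType) (f : M -> N) :
  continuous f -> injective f -> hausdorff_space N -> hausdorff_space M.
Proof.
move=> cf inj_f hN x y xy; apply/inj_f/hN => A B nA nB.
by have [z [Az Bz]] := xy _ _ (cf x A nA) (cf y B nB); exists (f z).
Qed.

(** The images of a countable basis under countably many open maps form a basis. *)
Lemma second_countable_cover (I : countType) (V N : topologicalType)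
    (e : I -> V -> N) :
  (forall i, continuous (e i)) -> (forall i O, open O -> open (e i @` O)) ->
  (forall y, exists i, range (e i) y) ->
  @second_countable V -> @second_countable N.
Proof.
move=> ce oe cov [B cB [oB bB]].
exists (\bigcup_(i in [set: I]) [set e i @` O | O in B]).
  by apply: bigcup_countable => // i _; exact: card_le_trans (card_image_le _ _) cB.
split=> [U [i _ [S BS <-]]|y A]; first by apply: oe; exact: oB.
have [i [v _ <-]] := cov y => nA; have [S [BS Sv] SA] := bB v _ (ce i v _ nA).
exists (e i @` S); last by move=> _ [u Su <-]; exact: SA.
by split; [exists i => //; exists S|exists v].
Qed.

Lemma mx_second_countable (R : realType) n m :
  @second_countable 'M[R]_(n, m).
Proof.
pose b (q : 'M[rat]_(n, m) * nat) : set 'M[R]_(n, m) :=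
  ball (map_mx ratr q.1 : 'M[R]_(n, m)) (q.2.+1%:R^-1 : R).
exists (range b); first exact: card_le_trans (card_image_le _ _) (countableP _).
split=> [_ [q _ <-]|x A /nbhs_ballP[e /= e0 eA]]; first exact: ball_open.
have [k ke] : exists k : nat, k.+1%:R^-1 < e / 2.
  have e2 : 0 < e / 2 by rewrite divr_gt0.
  by have [k] := ltr_add_invr e2; rewrite add0r; exists k.
have k0 : 0 < k.+1%:R^-1 :> R by rewrite invr_gt0.
have Q i j : exists q : rat, `|x i j - ratr q| < k.+1%:R^-1.
  have [|q] := @rat_in_itvoo R (x i j - k.+1%:R^-1) (x i j + k.+1%:R^-1).
    by rewrite ltrD2l gtrN.
  rewrite in_itv /= => /andP[q1 q2]; exists q.
  by rewrite ltr_distlC q1 q2.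
pose q := \matrix_(i, j) projT1 (cid (Q i j)).
have xq : ball (map_mx ratr q : 'M[R]_(n, m)) (k.+1%:R^-1 : R) x.
  apply: ball_sym; split=> // i j; rewrite !mxE.
  by case: (cid _).
exists (b (q, k)); first by split=> //; exists (q, k).
move=> y qy; apply: eA; rewrite (splitr e).
apply: (@ball_triangle _ _ (map_mx ratr q : 'M[R]_(n, m))).
  by apply: (le_ball (ltW ke)); exact: ball_sym.
exact: (le_ball (ltW ke)).
Qed.

Lemma mx_continuous_at (Z T : topologicalType) n m (F : Z -> 'M[T]_(n, m)) z :
  (forall i j, {for z, continuous (fun x => F x i j)}) -> {for z, continuous F}.
Proof.
move=> cF U [P /= nP PU].
have : \forall x \near z, forall i j, P i j (F x i j).
  apply: (@filter_forall _ _ (fun i x => forall j, P i j (F x i j)) (nbhs z)) => i.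
  apply: (@filter_forall _ _ (fun j x => P i j (F x i j)) (nbhs z)) => j.
  exact/cF/nP.
by apply: filterS => x Px; exact: PU.
Qed.

Section ChartInverse.
Variables (R : realType) (M : topologicalType) (V : normedModType R).
Variables (c : chart M V) (e : V -> M).
Hypotheses (oc : open (cdom c)) (ec : continuous e).
Hypotheses (cc : forall x, cdom c x -> {for x, continuous c}).
Hypotheses (ed : forall v, cdom c (e v)) (eK : cancel e c).
Hypothesis (cK : forall x, cdom c x -> e (c x) = x).

(** A chart whose inverse is continuous on the whole model space maps an open set to the
    preimage of that set under the inverse. *)
Lemma is_chart_inverse : is_chart c.
Proof.
split=> // [x y cx cy xy|O oO Oc]; first by rewrite -(cK cx) -(cK cy) xy.
rewrite (_ : c @` O = e @^-1` O); first exact: open_comp.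
apply/seteqP; split=> [_ [x Ox <-]|v Ov]; first by rewrite /= cK//; exact: Oc.
by exists (e v).
Qed.

Lemma chart_inverse_open O : open O -> open (e @` O).
Proof.
move=> oO; rewrite openE => _ [v Ov <-].
have nO : nbhs (e v) (c @^-1` O).
  by apply: (cc (ed v)); rewrite eK; exact: open_nbhs_nbhs.
apply: filterS2 (open_nbhs_nbhs (conj oc (ed v))) nO => x cx Ox.
by exists (c x) => //; exact: cK.
Qed.

End ChartInverse.

(** * Transport of a smooth structure along a homeomorphism *)

Section Transport.
Variables (R : realType) (M N : topologicalType) (V : normedModType R).
Variables (h : M -> N) (h' : N -> M) (B : atlas N V).
Hypotheses (hc : continuous h) (h'c : continuous h').
Hypotheses (hK : cancel h h') (h'K : cancel h' h).

Definition pull_chart (d : chart N V) : chart M V :=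
  @Chart R M V (h @^-1` cdom d) (d \o h).

Definition pull_atlas : atlas M V := [set pull_chart d | d in B].

(** A transition map between transported charts is literally a transition map of [B]. *)
Lemma pull_atlas_smooth : smooth_atlas B -> smooth_atlas pull_atlas.
Proof.
move=> [hN scN cB covB trB]; have oh' O : open O -> open (h' @` O).
  move=> oO; rewrite (_ : h' @` O = h @^-1` O); first exact: open_comp.
  apply/seteqP; split=> [_ [y Oy <-]|x Ox]; first by rewrite /= h'K.
  by exists (h x).
split.
- exact: injective_hausdorff hc (can_inj hK) hN.
- apply: (@second_countable_cover unit N M (fun=> h')) => // x.
  by exists tt, (h x).
- move=> _ [d Bd <-]; have [od injd cd opd] := cB _ Bd; split.
  + by apply: open_comp => // x _; exact: hc.
  + by move=> x y dx dy /(injd _ _ dx dy) /(can_inj hK).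
  + by move=> x dx; apply: continuous_comp; [exact: hc|exact: cd].
  + move=> O oO Od; rewrite (_ : pull_chart d @` O = d @` (h' @^-1` O)).
      apply: opd; first by apply: open_comp => // x _; exact: h'c.
      by move=> y /Od /=; rewrite h'K.
    apply/seteqP; split=> [_ [x Ox <-]|_ [y Oy <-]].
      by exists (h x); rewrite //= hK.
    by exists (h' y); rewrite //= h'K.
- move=> x; have [d Bd dx] := covB (h x).
  by exists (pull_chart d) => //; exists d.
- move=> _ _ [c Bc <-] [d Bd <-]; have [g [sg ge]] := trB _ _ Bc Bd.
  exists g; split=> [k|x cx dx]; last exact: ge.
  apply: Ck_subset (sg k) => _ [x [cx dx] <-].
  by exists (h x).
Qed.

Lemma pull_atlas_diffeomorphic : smooth_atlas B -> diffeomorphic pull_atlas B.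
Proof.
move=> [_ _ _ _ trB]; exists h; split; last (exists h'; split=> //).
  split=> // _ d [c Bc <-] Bd; have [g [sg ge]] := trB _ _ Bc Bd.
  exists g; split=> [k|x cx dx]; last exact: ge.
  by apply: Ck_subset (sg k) => _ [x [cx dx] <-]; exists (h x).
split=> // c _ Bc [d Bd <-]; have [g [sg ge]] := trB _ _ Bc Bd.
exists g; split=> [k|x cx /= dx]; last by rewrite h'K in dx *; exact: ge.
by apply: Ck_subset (sg k) => _ [x [cx /= dx] <-]; rewrite h'K in dx; exists x.
Qed.

End Transport.

(** * Homogeneous coordinates on projective space *)

Section HomogeneousCoordinates.
Variables (R : realType) (m : nat).
Implicit Types (X Y : 'cV[R]_m.+1) (v : 'rV[R]_m) (b : 'I_m.+1).

Definition ax_vec X : 'cV[R]_m.+1 := if X == 0 then const_mx 1 else X.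

Lemma ax_vec_neq0 X : ax_vec X != 0.
Proof.
rewrite /ax_vec; case: ifPn => // _; apply/eqP => /matrixP/(_ ord0 ord0).
by rewrite !mxE => /eqP; rewrite oner_eq0.
Qed.

(** The value at [X = 0] is irrelevant; totality lets [ax] be applied to expressions whose
    nonvanishing holds only on an open set or is proved afterwards. *)
Definition ax X : RP R m := axis (NZ (ax_vec_neq0 X)).

Lemma axE X (X0 : X != 0) : ax X = axis (NZ X0).
Proof.
apply/axisP; exists 1; first exact: oner_neq0.
by rewrite /= /ax_vec (negPf X0) scale1r.
Qed.

Lemma ax_val (X : @nzvec R m) : ax (val X) = axis X.
Proof.
by rewrite (axE (nzvecP X)); apply/axisP; exists 1; rewrite ?oner_eq0 ?scale1r.
Qed.

Lemma axP X Y : X != 0 -> Y != 0 ->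
  ax X = ax Y <-> exists2 l : R, l != 0 & Y = l *: X.
Proof. by move=> X0 Y0; rewrite (axE X0) (axE Y0) axisP. Qed.

Lemma axZ (l : R) X : l != 0 -> ax (l *: X) = ax X.
Proof.
move=> l0; have [->|X0] := eqVneq X 0; first by rewrite scaler0.
by apply/esym/axP; rewrite ?scaler_eq0 ?negb_or ?l0//; exists l.
Qed.

Lemma ax_surj (p : RP R m) : exists2 X, X != 0 & p = ax X.
Proof.
have [X ->] := axis_surj p; exists (val X); first exact: nzvecP.
by rewrite ax_val.
Qed.

Lemma open_neq0 n k : open [set M : 'M[R]_(n, k) | M != 0].
Proof.
rewrite (_ : mkset _ = ~` [set 0]); last by apply/seteqP; split=> M /= /eqP.
apply: closed_openC; apply: accessible_closed_set1.
exact/hausdorff_accessible/norm_hausdorff.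
Qed.

Lemma nbhs_neq0 X : X != 0 -> nbhs X [set Y | Y != 0].
Proof. by move=> X0; apply: open_nbhs_nbhs; split=> //; exact: open_neq0. Qed.

Lemma ax_continuous_at X : X != 0 -> {for X, continuous ax}.
Proof.
move=> X0 U; rewrite nbhsE => -[A [oA AX] AU].
have [W oW WE] : open (@axis R m @^-1` A) by exact: oA.
have WX : W X.
  have : (@axis R m @^-1` A) (NZ X0) by rewrite /= -axE.
  by rewrite -WE.
have nW : nbhs X W by exact: open_nbhs_nbhs.
have nX := nbhs_neq0 X0.
apply: filterS2 nW nX => Y WY Y0; apply: AU.
have : (set_val @^-1` W) (NZ Y0) by exact: WY.
by rewrite WE /= -axE.
Qed.

(** The projection onto projective space is open, because the saturation of an open set
    of vectors is the union of its images under the scalings. *)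
Lemma ax_open (A : set 'cV[R]_m.+1) : open A -> A `<=` [set X | X != 0] ->
  open (ax @` A).
Proof.
move=> oA A0; suff : open (@axis R m @^-1` (ax @` A)) by [].
exists (\bigcup_(l in [set l : R | l != 0]) (( *:%R l) @^-1` A)).
  apply: bigcup_open => l _; apply: open_comp => // Y _; exact: scaler_continuous.
apply/seteqP; split=> [Y [l /= l0 AlY]|Y [X AX]].
  by exists (l *: val Y); rewrite // axZ// ax_val.
rewrite -ax_val => /axP[|| l l0 e]; [exact: A0|exact: nzvecP|].
exists l^-1; first by rewrite /= invr_eq0.
suff : A (l^-1 *: val Y) by [].
by rewrite e scalerA mulVf// scale1r.
Qed.

(** Since the projection is open, continuity at an axis can be tested on representatives. *)
Lemma continuous_at_ax (Z : topologicalType) (f : RP R m -> Z) X : X != 0 ->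
  {for X, continuous (f \o ax)} -> {for ax X, continuous f}.
Proof.
move=> X0 cf U /cf /=.
have nX := nbhs_neq0 X0.
move=> /(filterI nX); rewrite nbhsE => -[A [oA AX] AU].
suff : nbhs (ax X) (ax @` A) by apply: filterS => _ [Y /AU[_ fY] <-].
apply: open_nbhs_nbhs; split; last by exists X.
by apply: ax_open => // Y /AU[].
Qed.

Definition dehom b X : 'rV[R]_m := \row_j (X (lift b j) 0 / X b 0).

(** The representative with coordinate 1 at the pivot [b]. *)
Definition hom b v : 'cV[R]_m.+1 :=
  \col_i (if unlift b i is Some j then v 0 j else 1).

Lemma hom_pivot b v : hom b v b 0 = 1.
Proof. by rewrite mxE unlift_none. Qed.

Lemma hom_neq0 b v : hom b v != 0.
Proof.
by apply/eqP => /matrixP/(_ b 0); rewrite hom_pivot mxE => /eqP; rewrite oner_eq0.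
Qed.

Lemma homK b v : dehom b (hom b v) = v.
Proof. by apply/rowP => j; rewrite !mxE unlift_none liftK divr1. Qed.

Lemma dehomK b X : X b 0 != 0 -> hom b (dehom b X) = (X b 0)^-1 *: X.
Proof.
move=> Xb; apply/colP => i; rewrite !mxE.
by case: unliftP => [j|] ->; rewrite ?mxE ?mulVf// mulrC.
Qed.

Lemma coord_neq0 X b : X b 0 != 0 -> X != 0.
Proof. by apply: contra => /eqP ->; rewrite mxE. Qed.

Lemma exists_coord_neq0 X : X != 0 -> exists i, X i 0 != 0.
Proof.
move=> X0; apply: contrapT => h; case/eqP: X0; apply/colP => i; rewrite mxE.
by apply/eqP/negPn/negP => Xi; apply: h; exists i.
Qed.

Lemma affine_chart_dom b X : X != 0 ->
  cdom (affine_chart R b) (ax X) <-> X b 0 != 0.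
Proof. by move=> X0; rewrite (axE X0); have [] := affine_chart_axis b (NZ X0). Qed.

Lemma affine_chart_ax b X : X != 0 -> affine_chart R b (ax X) = dehom b X.
Proof. by move=> X0; rewrite (axE X0); have [] := affine_chart_axis b (NZ X0). Qed.

(** The orthogonal projector X X^T / X^T X onto an axis depends continuously on the axis and
    determines it, since its nonzero columns lie on the axis; so projective space injects
    continuously into the matrices. *)
Lemma RP_hausdorff : hausdorff_space (RP R m).
Proof.
pose proj X : 'M[R]_m.+1 := ((X^T *m X) 0 0)^-1 *: (X *m X^T).
have sq_neq0 X : X != 0 -> (X^T *m X) 0 0 != 0.
  move=> X0; rewrite mxE psumr_neq0; last first.
    by move=> i _; rewrite mxE -expr2 sqr_ge0.
  have [i Xi] := exists_coord_neq0 X0.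
  apply/hasP; exists i; first by rewrite mem_index_enum.
  by rewrite /= mxE -expr2 lt0r sqrf_eq0 Xi sqr_ge0.
have projZ l X : l != 0 -> proj (l *: X) = proj X.
  move=> l0; rewrite /proj [(l *: X)^T]linearZ /= -!scalemxAr -!scalemxAl !scalerA !mxE.
  set s := \sum_j _; congr (_ *: _).
  by rewrite [_ * s]mulrC invfM -mulrA mulVf ?mulr1// mulf_neq0.
pose f (p : RP R m) := proj (val (repr p : @nzvec R m)).
have fE X : X != 0 -> f (ax X) = proj X.
  move=> X0; rewrite /f.
  have : ax X = ax (val (repr (ax X) : @nzvec R m)) by rewrite ax_val /axis reprK.
  by case/(axP X0 (nzvecP _)) => l l0 ->; rewrite projZ.
apply: (@injective_hausdorff _ 'M[R]_m.+1 f); last exact: norm_hausdorff.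
  move=> p; have [X X0 ->] := ax_surj p; apply: (continuous_at_ax X0).
  have oU := @open_neq0 m.+1 1.
  have nX := nbhs_neq0 X0.
  suff : {for X, continuous proj}.
    by apply: near_eq_continuous_at; apply: filterS nX => Y Y0; rewrite /= fE.
  have s : smooth_on [set Y : 'cV[R]_m.+1 | Y != 0] proj.
    apply: smooth_matrix => // i j k; 
    rewrite (_ : (fun Y => _) = fun Y => ((Y^T *m Y) 0 0)^-1 * (Y *m Y^T) i j); last first.
      by apply/funext => Y; rewrite mxE.
    apply: CkM => //; [apply: CkV => // | ]; apply: smooth_mulmx => //.
    + by apply: smooth_trmx; exact: smooth_entry.
    + exact: smooth_entry.
    + exact: smooth_entry.
    + by apply: smooth_trmx; exact: smooth_entry.
  exact: (s 0).
move=> p q; have [X X0 ->] := ax_surj p; have [Y Y0 ->] := ax_surj q.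
rewrite !fE// => e; have [i Xi] := exists_coord_neq0 X0.
have col_proj Z : col i (proj Z) = (Z i 0 / (Z^T *m Z) 0 0) *: Z.
  apply/colP => j; rewrite !mxE big_ord1 !mxE; set s := (X in X^-1).
  by rewrite mulrCA mulrC [s^-1 * _]mulrC.
have := congr1 (col i) e; rewrite !col_proj => eXY.
rewrite -(@axZ (X i 0 / (X^T *m X) 0 0)) ?mulf_neq0 ?invr_eq0 ?sq_neq0// eXY axZ//.
apply/eqP => z; move: eXY; rewrite z scale0r => /eqP.
by rewrite scaler_eq0 mulf_eq0 invr_eq0 (negPf Xi) (negPf (sq_neq0 _ X0)) (negPf X0).
Qed.

End HomogeneousCoordinates.

(** * Powers of projective space *)

Section PowerOfRP.
Variables (R : realType) (m n : nat).
Implicit Types (a b : 'I_n -> 'I_m.+1).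

Definition pts (X : 'I_n -> 'cV[R]_m.+1) : {ptws 'I_n -> RP R m} :=
  fun i => ax (X i).

Definition coord_mx a (X : 'I_n -> 'cV[R]_m.+1) : 'M[R]_(n, m) :=
  \matrix_(i, j) dehom (a i) (X i) 0 j.

Definition homs a (N : 'M[R]_(n, m)) : 'I_n -> 'cV[R]_m.+1 :=
  fun i => hom (a i) (row i N).

Definition RPn_chart a : chart {ptws 'I_n -> RP R m} 'M[R]_(n, m) :=
  power_chart (fun i => affine_chart R (a i)).

Lemma RPn_atlasP c :
  power_atlas n (RP_atlas R m) c <-> exists a, c = RPn_chart a.
Proof.
split=> [[f fA <-]|[a ->]]; last by exists (fun i => affine_chart R (a i)) => // i; exists (a i).
have /choice[a aP] : forall i, exists j, affine_chart R j = f i.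
  by move=> i; have [j _ <-] := fA i; exists j.
by exists a; rewrite /RPn_chart; congr power_chart; apply/funext => i; rewrite aP.
Qed.

Lemma RPn_chart_dom a X : (forall i, X i != 0) ->
  cdom (RPn_chart a) (pts X) <-> forall i, X i (a i) 0 != 0.
Proof. by move=> X0; split=> h i; apply/(affine_chart_dom (a i) (X0 i)); exact: h. Qed.

Lemma RPn_chart_pts a X : (forall i, X i != 0) ->
  RPn_chart a (pts X) = coord_mx a X.
Proof. by move=> X0; apply/matrixP => i j; rewrite [LHS]mxE [RHS]mxE /pts affine_chart_ax. Qed.

Lemma pts_surj p : exists2 X, (forall i, X i != 0) & p = pts X.
Proof.
have /choice[X XP] : forall i, exists X : 'cV[R]_m.+1, X != 0 /\ p i = ax X.
  by move=> i; have [X X0 e] := ax_surj (p i); exists X.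
by exists X; [move=> i; case: (XP i)|apply/funext => i; case: (XP i)].
Qed.

Lemma homs_neq0 a N i : homs a N i != 0.
Proof. exact: hom_neq0. Qed.

Lemma homsK a N : coord_mx a (homs a N) = N.
Proof. by apply/matrixP => i j; rewrite [LHS]mxE homK mxE. Qed.

Lemma homs_dom a N : cdom (RPn_chart a) (pts (homs a N)).
Proof.
apply/RPn_chart_dom => [i|i]; first exact: homs_neq0.
by rewrite hom_pivot oner_neq0.
Qed.

Lemma homs_chartK a N : RPn_chart a (pts (homs a N)) = N.
Proof. by rewrite RPn_chart_pts ?homsK// => i; exact: homs_neq0. Qed.

Lemma RPn_chartK a p : cdom (RPn_chart a) p -> pts (homs a (RPn_chart a p)) = p.
Proof.
have [X X0 ->] := pts_surj p => /(RPn_chart_dom a X0) Xa.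
rewrite RPn_chart_pts//; apply/funext => i; rewrite /pts /homs.
rewrite (_ : row i _ = dehom (a i) (X i)); last by apply/rowP => j; rewrite !mxE.
by rewrite dehomK// axZ// invr_eq0.
Qed.

Lemma pts_continuous_at (Z : topologicalType) (X : Z -> 'I_n -> 'cV[R]_m.+1) z :
  (forall i, X z i != 0) -> (forall i, {for z, continuous (fun x => X x i)}) ->
  {for z, continuous (fun x => pts (X x))}.
Proof.
move=> X0 cX; apply: ptws_continuous_at => i.
by apply: continuous_comp; [exact: cX|exact: ax_continuous_at].
Qed.

Section SmoothCoordinates.
Variables (V : normedModType R) (X : V -> 'I_n -> 'cV[R]_m.+1).
Hypothesis sX : forall i l, smooth_on setT (fun x => X x i l 0 : R).

Lemma smooth_coord_continuous i : continuous (fun x => X x i).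
Proof.
move=> x; suff s : smooth_on setT (fun x => X x i) by exact: (s 0).
by apply: smooth_matrix; [exact: openT|move=> l j; rewrite [j]ord1].
Qed.

Lemma open_coord_dom a : open [set x | forall i, X x i (a i) 0 != 0].
Proof.
rewrite openE => x Xx.
suff : \forall y \near x, forall i, X y i (a i) 0 != 0 by [].
apply: (@filter_forall _ _ (fun i y => X y i (a i) 0 != 0) (nbhs x)) => i.
have c := sX i (a i) 0%N x I.
apply: (c [set r | r != 0]).
by apply: open_nbhs_nbhs; split; [exact: open_neq|exact: Xx].
Qed.

(** In affine charts the family of points [pts (X x)] is a quotient of smooth functions. *)
Lemma smooth_coord_mx a :
  smooth_on [set x | forall i, X x i (a i) 0 != 0] (fun x => coord_mx a (X x)).
Proof.
have oU := open_coord_dom a; apply: smooth_matrix => // i j k.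
rewrite (_ : (fun x => _) = fun x => X x i (lift (a i) j) 0 / X x i (a i) 0); last first.
  by apply/funext => x; rewrite !mxE.
apply: CkM => //.
  by apply: Ck_subset (sX _ _ k).
by apply: CkV => //; apply: Ck_subset (sX _ _ k).
Qed.

End SmoothCoordinates.

Lemma smooth_homs a i l : smooth_on setT (fun N => homs a N i l 0 : R).
Proof.
move=> k; under eq_fun do rewrite mxE.
case: unlift => [j|]; last exact: Ck_cst.
by under eq_fun do rewrite mxE; exact: smooth_entry.
Qed.

(** This is the inverse of the affine chart [a]. *)
Lemma homs_continuous a : continuous (fun N => pts (homs a N)).
Proof.
move=> N; apply: pts_continuous_at => i; first exact: homs_neq0.
exact: (smooth_coord_continuous (smooth_homs a)).
Qed.

Lemma RPn_chart_open a : open (cdom (RPn_chart a)).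
Proof.
apply: (@ptws_open_box _ _ (fun i => cdom (affine_chart R (a i)))) => i.
have -> : cdom (affine_chart R (a i)) = @ax R m @` [set X : 'cV[R]_m.+1 | X (a i) 0 != 0].
  apply/seteqP; split=> [_ [X Xa <-]|_ [X Xa <-]].
    by exists (val X) => //; exact: ax_val.
  by apply/affine_chart_dom => //; exact: coord_neq0 Xa.
apply: ax_open => [|X /=]; last exact: coord_neq0.
apply: (@open_comp _ _ (fun X : 'cV[R]_m.+1 => X (a i) 0) [set r | r != 0]).
  by move=> X _; exact: coord_continuous.
exact: open_neq.
Qed.

Lemma RPn_chart_continuous a p :
  cdom (RPn_chart a) p -> {for p, continuous (RPn_chart a)}.
Proof.
have [X X0 ->] := pts_surj p => /(RPn_chart_dom a X0) Xa.
apply: mx_continuous_at => i j.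
rewrite (_ : (fun q => _) = fun q => affine_chart R (a i) (q i) 0 j); last first.
  by apply/funext => q; rewrite mxE.
apply: (@continuous_comp _ _ _ (fun q : {ptws 'I_n -> RP R m} => q i)
  (fun p => affine_chart R (a i) p 0 j)); first exact: ptws_eval_continuous.
apply: (continuous_at_ax (X0 i)).
have cc l : {for X i, continuous (fun Y : 'cV[R]_m.+1 => Y l 0)}.
  exact: coord_continuous.
have cq : {for X i,
    continuous (fun Y : 'cV[R]_m.+1 => Y (lift (a i) j) 0 / Y (a i) 0)}.
  by apply: continuousM; [exact: cc|apply: continuousV; [exact: Xa|exact: cc]].
apply: near_eq_continuous_at cq.
by apply: filterS (nbhs_neq0 (X0 i)) => Y Y0; rewrite /comp affine_chart_ax// mxE.
Qed.

Lemma RPn_chart_cover p : exists a, cdom (RPn_chart a) p.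
Proof.
have [X X0 ->] := pts_surj p.
have /choice[a Xa] i := exists_coord_neq0 (X0 i).
by exists a; apply/RPn_chart_dom.
Qed.

Lemma RPn_is_chart a : is_chart (RPn_chart a).
Proof.
apply: (@is_chart_inverse _ _ _ _ (fun N => pts (homs a N))).
- exact: RPn_chart_open.
- exact: homs_continuous.
- exact: RPn_chart_continuous.
- exact: homs_chartK.
- exact: RPn_chartK.
Qed.

Lemma RPn_smooth_atlas : smooth_atlas (power_atlas n (RP_atlas R m)).
Proof.
split.
- exact/ptws_hausdorff/RP_hausdorff.
- pose e (a : {ffun 'I_n -> 'I_m.+1}) N := pts (homs a N).
  apply: (second_countable_cover (e := e)); last exact: mx_second_countable.
  + by move=> a; exact: homs_continuous.
  + move=> a; apply: (@chart_inverse_open _ _ _ (RPn_chart a)).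
    * exact: RPn_chart_open.
    * exact: RPn_chart_continuous.
    * exact: homs_dom.
    * exact: homs_chartK.
    * exact: RPn_chartK.
  + move=> p; have [a pa] := RPn_chart_cover p; exists (finfun a).
    exists (RPn_chart a p) => //; rewrite /e (_ : finfun a = a :> (_ -> _)) ?RPn_chartK//.
    by apply/funext => i; rewrite ffunE.
- by move=> c /RPn_atlasP[a ->]; exact: RPn_is_chart.
- move=> p; have [a pa] := RPn_chart_cover p; exists (RPn_chart a) => //.
  by apply/RPn_atlasP; exists a.
- move=> c d /RPn_atlasP[a ->] /RPn_atlasP[b ->].
  exists (fun N => coord_mx b (homs a N)); split=> [k|p pa pb]; last first.
    rewrite -(RPn_chart_pts b) ?RPn_chartK// => i; exact: homs_neq0.
  apply: Ck_subset (smooth_coord_mx (smooth_homs a) b k) => _ [p [pa pb] <-].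
  apply/RPn_chart_dom; first by move=> i; exact: homs_neq0.
  by rewrite RPn_chartK.
Qed.

End PowerOfRP.

(** * Projective frames *)

Section Frames.
Variables (R : realType) (m : nat).
Implicit Types (A : 'M[R]_m.+1) (Y : 'cV[R]_m.+1).

Definition cols (X : 'I_m.+1 -> 'cV[R]_m.+1) : 'M[R]_m.+1 := \matrix_(i, j) X j i 0.

Lemma cols_delta (X : 'I_m.+1 -> 'cV[R]_m.+1) j : cols X *m delta_mx j 0 = X j.
Proof. by rewrite -colE; apply/colP => i; rewrite !mxE. Qed.

Lemma mulmx_cols A (X : 'I_m.+1 -> 'cV[R]_m.+1) :
  A *m cols X = cols (fun j => A *m X j).
Proof.
by apply/matrixP => i j; rewrite !mxE; apply: eq_bigr => l _; rewrite mxE.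
Qed.

Lemma row_mulmx_cols (u : 'rV[R]_m.+1) (X : 'I_m.+1 -> 'cV[R]_m.+1) j :
  (u *m cols X) 0 j = (u *m X j) 0 0.
Proof. by rewrite !mxE; apply: eq_bigr => i _; rewrite mxE. Qed.

Lemma mulmx_unit_neq0 A Y : A \in unitmx -> (A *m Y != 0) = (Y != 0).
Proof.
move=> uA; congr (~~ _); apply/eqP/eqP => [e|->]; last by rewrite mulmx0.
by rewrite -(mulKmx uA Y) e mulmx0.
Qed.

(** A linear variety contains the axes of the [X j] exactly when its vector space contains
    the image of the matrix [cols X], and this image is itself the space of a variety. *)
Lemma linear_span_setT (X : 'I_m.+1 -> 'cV[R]_m.+1) : (forall j, X j != 0) ->
  linear_span (range (fun j => ax (X j))) = setT <-> cols X \in unitmx.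
Proof.
move=> X0; split=> [spanT|uX].
  pose f := linfun (@mulmx R m.+1 m.+1 1 (cols X)); pose V := limg f.
  have XV j : X j \in V.
    by rewrite -(cols_delta X j) -(lfunE (@mulmx R m.+1 m.+1 1 (cols X))) memv_img ?memvf.
  have [d dV] : exists d, \dim V = d.+1.
    case: (posnP (\dim V)) => [/eqP|]; last by case: (\dim V) => // d _; exists d.
    rewrite dimv_eq0 => /eqP V0; have := XV ord0.
    by rewrite V0 memv0 (negPf (X0 _)).
  have VT Y : Y != 0 -> Y \in V.
    move=> Y0; have : linear_span (range (fun j => ax (X j))) (ax Y) by rewrite spanT.
    move=> /(_ [set axis Z | Z in [set Z : @nzvec R m | val Z \in V]])[].
      split; first by exists d, V.
      move=> _ [j _ <-]; exists (NZ (X0 j)); first exact: XV.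
      by rewrite (axE (X0 j)).
    move=> Z ZV; rewrite -ax_val => /(axP (nzvecP Z) Y0)[l l0 ->].
    exact: memvZ.
  have /choice[g gP] : forall j, exists u, cols X *m u = (delta_mx j 0 : 'cV_m.+1).
    move=> j; have /memv_imgP[u _ e] : (delta_mx j 0 : 'cV[R]_m.+1) \in V.
      apply: VT; apply/eqP => /matrixP/(_ j 0); rewrite !mxE !eqxx => /eqP.
      by rewrite oner_eq0.
    by exists u; rewrite e lfunE.
  suff /mulmx1_unit[] : cols X *m cols g = 1%:M by [].
  rewrite mulmx_cols; apply/matrixP => i j; rewrite [LHS]mxE gP !mxE eqxx andbT.
  by [].
apply/seteqP; split=> // p _ _ [[d [V dV ->]] XV].
have XjV j : X j \in V.
  have [Z ZV] := XV _ (ex_intro2 _ _ j I erefl).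
  rewrite -ax_val => /(axP (nzvecP Z) (X0 j))[l l0 ->].
  exact: memvZ.
have [Y Y0 ->] := ax_surj p; exists (NZ Y0); last by rewrite (axE Y0).
rewrite /= -(mulKVmx uX Y) [invmx _ *m Y]matrix_sum_delta mulmx_sumr memv_suml// => i _.
rewrite mulmx_sumr memv_suml// => j _.
by rewrite [j]ord1 -scalemxAr cols_delta; exact: memvZ.
Qed.

Definition std_frame (a : 'I_m.+2) : 'cV[R]_m.+1 :=
  if unlift ord_max a is Some j then delta_mx j 0 else const_mx 1.

Definition is_frame (X : 'I_m.+2 -> 'cV[R]_m.+1) : Prop :=
  forall f : 'I_m.+1 -> 'I_m.+2, injective f -> cols (X \o f) \in unitmx.

Lemma projective_frameP (X : 'I_m.+2 -> 'cV[R]_m.+1) : (forall a, X a != 0) ->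
  projective_frame (fun a => ax (X a)) <-> is_frame X.
Proof.
move=> X0; split=> [[_ h] f inj_f|h]; last split=> // f inj_f.
  by apply/linear_span_setT => [j|]; [exact: X0|exact: h].
by apply/(linear_span_setT (X := X \o f)) => [j|]; [exact: X0|exact: h].
Qed.

Lemma std_frame_lift j : std_frame (lift ord_max j) = delta_mx j 0.
Proof. by rewrite /std_frame liftK. Qed.

Lemma std_frame_last : std_frame ord_max = const_mx 1.
Proof. by rewrite /std_frame unlift_none. Qed.

Lemma std_frame_neq0 a : std_frame a != 0.
Proof.
case: (unliftP ord_max a) => [j|] ->; rewrite ?std_frame_lift ?std_frame_last.
  apply/eqP => /matrixP/(_ j 0); rewrite !mxE !eqxx => /eqP.
  by rewrite oner_eq0.
by apply/eqP => /matrixP/(_ ord0 0); rewrite !mxE => /eqP; rewrite oner_eq0.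
Qed.

Lemma inj_misses_one (f : 'I_m.+1 -> 'I_m.+2) : injective f ->
  exists a0, forall a, a != a0 -> exists j, f j = a.
Proof.
move=> inj_f; have : #|[predC codom f]| = 1%N.
  by apply/eqP; rewrite -(eqn_add2l #|codom f|) cardC card_codom// !card_ord addn1.
move/eqP/card1P => [a0 a0P]; exists a0 => a /negPf aa0.
have /negbFE/codomP[j ->] : (a \notin codom f) = false by have := a0P a; rewrite !inE aa0.
by exists j.
Qed.

(** A linear form that vanishes on all vectors of the standard frame but one vanishes: if the
    exception is e_i, the value at e_i is the value at the sum e_0 + ... + e_m. *)
Lemma std_frame_is_frame : is_frame std_frame.
Proof.
move=> f inj_f; rewrite -row_free_unit; apply: inj_row_free => u u0.
have uE j : (u *m std_frame (f j)) 0 0 = 0.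
  have := congr1 (fun v : 'rV[R]_m.+1 => v 0 j) u0.
  by rewrite row_mulmx_cols => ->; rewrite mxE.
have [a0 a0P] := inj_misses_one inj_f.
have ud j : lift ord_max j != a0 -> u 0 j = 0.
  move=> /a0P[l e]; have := uE l; rewrite e std_frame_lift -colE !mxE; exact.
have us : ord_max != a0 -> \sum_j u 0 j = 0.
  move=> /a0P[l e]; have := uE l; rewrite e std_frame_last mxE; apply: etrans.
  by apply: eq_bigr => j _; rewrite mxE mulr1.
case: (unliftP ord_max a0) => [i|] a0E; apply/rowP => j; rewrite [RHS]mxE.
  have uj l : l != i -> u 0 l = 0.
    by move=> li; apply: ud; rewrite a0E (inj_eq (@lift_inj _ _)).
  have [->|/uj//] := eqVneq j i.
  have /us : ord_max != a0 by rewrite a0E neq_lift.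
  by rewrite (bigD1 i)//= big1 ?addr0// => l /uj.
by apply: ud; rewrite a0E eq_sym neq_lift.
Qed.

(** The last vector of a frame has no zero coordinate in the basis formed by the others:
    otherwise the family in which it replaces the corresponding basis vector would be
    dependent. The adjugate yields these coordinates up to the factor [\det B]. *)
Lemma frame_unit_neq0 (X : 'I_m.+2 -> 'cV[R]_m.+1) i : is_frame X ->
  (\adj (cols (X \o lift ord_max)) *m X ord_max) i 0 != 0.
Proof.
move=> frX; set B := cols _; have uB : B \in unitmx by apply: frX; exact: lift_inj.
(* [C] is [B] with the vector of index [i] replaced by the last vector of the frame. *)
have uC := frX _ (@lift_inj _ (lift ord_max i)).
apply/eqP => W0; set C := cols _ in uC.
pose u : 'rV_m.+1 := row i (\adj B).
have u0 : u *m C = 0.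
  apply/rowP => j; rewrite row_mulmx_cols /= -row_mul [LHS]mxE [RHS]mxE.
  case: (unliftP ord_max (lift (lift ord_max i) j)) => [l|] e; rewrite e//.
  have : X (lift ord_max l) = B *m delta_mx l 0 by rewrite cols_delta.
  move=> ->; rewrite mulmxA mul_adj_mx -[_%:M]scalemx1 -scalemxAl mul1mx !mxE.
  have /negPf -> : i != l; last by rewrite mulr0.
  apply/eqP => il; have := neq_lift (lift ord_max i) j.
  by rewrite e il eqxx.
have : \adj B \in unitmx.
  by have := unitmx_inv B; rewrite uB /invmx uB unitmxZ ?unitrV -?unitmxE.
move=> uadj; have : (delta_mx 0 i : 'rV[R]_m.+1) *m \adj B *m C = 0 by rewrite -rowE.
move/(congr1 (mulmx^~ (invmx C))); rewrite mulmxK// mul0mx.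
move/(congr1 (mulmx^~ (invmx (\adj B)))); rewrite mulmxK// mul0mx.
move/matrixP/(_ 0 i); rewrite !mxE !eqxx => /eqP; by rewrite oner_eq0.
Qed.

(** With B the matrix of the first vectors and U the last one, these are the coordinates
    (B^-1 Y)_i / (B^-1 U)_i of Y relative to the frame, up to the common nonzero factor
    \prod_l (\adj B *m U)_l, which makes them polynomial. *)
Definition frame_coord (X : 'I_m.+2 -> 'cV[R]_m.+1) Y : 'cV[R]_m.+1 :=
  let B := cols (X \o lift ord_max) in
  \col_i ((\adj B *m Y) i 0 * \prod_(l | l != i) (\adj B *m X ord_max) l 0).

(** Scale the columns of B by the coordinates W of the last vector U relative to them, so that
    U becomes a multiple of their sum: B diag(W) then maps the standard frame to the given
    one, and the coordinates relative to the frame are those pulled back by this matrix. *)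
Lemma frame_coordP (X : 'I_m.+2 -> 'cV[R]_m.+1) :
  is_frame X ->
  exists A, [/\ A \in unitmx, forall a, ax (A *m std_frame a) = ax (X a)
    & forall Y, ax (A *m frame_coord X Y) = ax Y].
Proof.
move=> frX; set B := cols (X \o lift ord_max).
have uB : B \in unitmx by apply: frX; exact: lift_inj.
pose W := \adj B *m X ord_max; have W0 i : W i 0 != 0 by exact: frame_unit_neq0.
have detB0 : \det B != 0 by rewrite -unitfE -unitmxE.
have adjK Y : B *m (\adj B *m Y) = \det B *: Y.
  by rewrite mulmxA mul_mx_adj -[_%:M]scalemx1 -scalemxAl mul1mx.
exists (B *m diag_mx W^T); split.
- rewrite unitmx_mul uB unitmxE det_diag unitfE prodf_seq_neq0.
  by apply/allP => i _; rewrite mxE W0.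
- move=> a; rewrite -mulmxA; case: (unliftP ord_max a) => [j|] ->.
    rewrite std_frame_lift (_ : diag_mx _ *m _ = W j 0 *: delta_mx j 0).
      by rewrite -scalemxAr cols_delta axZ.
    apply/colP => i; rewrite mul_diag_mx !mxE eqxx andbT.
    by case: eqP => [->//|]; rewrite !mulr0.
  rewrite std_frame_last (_ : diag_mx _ *m _ = W).
    by rewrite adjK axZ.
  by apply/colP => i; rewrite mul_diag_mx !mxE mulr1.
- move=> Y; rewrite -mulmxA (_ : diag_mx _ *m _ = (\prod_l W l 0) *: (\adj B *m Y)).
    rewrite -scalemxAr adjK !axZ//; apply/prodf_neq0 => i _; exact: W0.
  apply/colP => i; rewrite mul_diag_mx [LHS]mxE [RHS]mxE [W^T 0 i]mxE.
  rewrite [frame_coord X Y i 0]mxE -/B -/W [in RHS](bigD1 i)//=.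
  by rewrite -mulrA; congr (_ * _); rewrite mulrC.
Qed.

Lemma frame_coord_neq0 X Y : is_frame X -> Y != 0 -> frame_coord X Y != 0.
Proof.
move=> frX; set B := cols (X \o lift ord_max).
have uB : B \in unitmx by apply: frX; exact: lift_inj.
apply: contra => /eqP fc0; have N0 : \adj B *m Y = 0.
  apply/colP => i; move/colP/(_ i): fc0; rewrite [LHS]mxE [RHS]mxE => /eqP.
  rewrite mulf_eq0 => /orP[/eqP ->|]; first by rewrite mxE.
  by move/prodf_eq0 => [l _]; rewrite (negPf (frame_unit_neq0 _ frX)).
have := mul_mx_adj B; move/(congr1 (mulmx^~ Y)).
rewrite -mulmxA N0 mulmx0 -[_%:M]scalemx1 -scalemxAl mul1mx => /esym/eqP.
by rewrite scaler_eq0 -(negbK (_ == _)) -unitfE -unitmxE uB.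
Qed.

Lemma PGL_mx (al : RP R m -> RP R m) : PGL al ->
  exists2 A, A \in unitmx & forall Y, Y != 0 -> al (ax Y) = ax (A *m Y).
Proof.
move=> [A [uA alE]]; exists A => // Y Y0; rewrite (axE Y0) alE -ax_val.
by [].
Qed.

Lemma mx_PGL A : A \in unitmx ->
  exists2 al : RP R m -> RP R m, PGL al & forall Y, Y != 0 -> al (ax Y) = ax (A *m Y).
Proof.
move=> uA; pose al (p : RP R m) := ax (A *m val (repr p : @nzvec R m)).
have alE Y : Y != 0 -> al (ax Y) = ax (A *m Y).
  move=> Y0; have : ax Y = ax (val (repr (ax Y) : @nzvec R m)).
    by rewrite ax_val /axis reprK.
  by case/(axP Y0 (nzvecP _)) => l l0 e; rewrite /al e -scalemxAr axZ.
exists al => //; exists A, uA => X; rewrite -ax_val alE ?nzvecP//.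
by rewrite -ax_val.
Qed.

(** Fixing the coordinate axes makes the matrix diagonal; fixing the axis of e_0 + ... + e_m
    makes the diagonal constant. *)
Lemma fixes_std_frame A : A \in unitmx ->
  (forall a, ax (A *m std_frame a) = ax (std_frame a)) ->
  exists2 l : R, l != 0 & A = l%:M.
Proof.
move=> uA fixA.
have /choice[s sP] a : exists l : R, l != 0 /\ A *m std_frame a = l *: std_frame a.
  have /esym/axP[||l l0 e] := fixA a; rewrite ?mulmx_unit_neq0 ?std_frame_neq0//.
  by exists l.
have [l0 lE] := sP ord_max; exists (s ord_max) => //.
have cA i j : A i j = s (lift ord_max j) * (i == j)%:R.
  have [_] := sP (lift ord_max j); rewrite std_frame_lift -colE => /colP/(_ i).
  by rewrite !mxE eqxx andbT.
have sE i : s (lift ord_max i) = s ord_max.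
  move/colP/(_ i): lE; rewrite std_frame_last !mxE mulr1 (bigD1 i)//= big1.
    by rewrite addr0 cA eqxx mxE !mulr1.
  by move=> j ji; rewrite cA eq_sym (negPf ji) mulr0 mul0r.
by apply/matrixP => i j; rewrite cA sE mxE mulr_natr.
Qed.

End Frames.

(** * Normal form of a projective k-ad *)

Section Shapes.
Variables (R : realType) (m k : nat) (hk : (m.+2 < k)%N).
Local Notation q := (k - m - 2)%N.

Lemma frame_plus_rest : (k = m.+2 + q)%N.
Proof. by rewrite -subnDA addn2 subnKC// ltnW. Qed.

Definition head (a : 'I_m.+2) : 'I_k := widen_ord (ltnW hk) a.
Definition tail (j : 'I_q) : 'I_k := cast_ord (esym frame_plus_rest) (rshift m.+2 j).

Definition glue (T : Type) (F : 'I_m.+2 -> T) (y : 'I_q -> T) (i : 'I_k) : T :=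
  match fintype.split (cast_ord frame_plus_rest i) with inl a => F a | inr j => y j end.

Lemma glue_head (T : Type) (F : 'I_m.+2 -> T) y a : glue F y (head a) = F a.
Proof.
rewrite /glue (_ : cast_ord _ _ = lshift q a) ?(unsplitK (inl a))//.
exact: val_inj.
Qed.

Lemma glue_tail (T : Type) (F : 'I_m.+2 -> T) y j : glue F y (tail j) = y j.
Proof. by rewrite /glue cast_ordKV (unsplitK (inr j)). Qed.

Lemma head_tail i : (exists a, i = head a) \/ (exists j, i = tail j).
Proof.
rewrite -(cast_ordK frame_plus_rest i) -(splitK (cast_ord _ i)).
case: (fintype.split _) => [a|j]; [left; exists a|right; exists j => //].
exact: val_inj.
Qed.

Definition shape_coord (X : 'I_k -> 'cV[R]_m.+1) (j : 'I_q) : 'cV[R]_m.+1 :=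
  frame_coord (X \o head) (X (tail j)).

Lemma Gkm_frame (X : 'I_k -> 'cV[R]_m.+1) : (forall i, X i != 0) ->
  Gkm R hk (pts X) <-> is_frame (X \o head).
Proof. by move=> X0; apply: projective_frameP => a; exact: X0. Qed.

Lemma std_Gkm (y : {ptws 'I_q -> RP R m}) :
  Gkm R hk (glue (fun a : 'I_m.+2 => ax (std_frame R a)) y).
Proof.
suff -> : Gkm R hk (glue (fun a : 'I_m.+2 => ax (std_frame R a)) y)
        = projective_frame (fun a : 'I_m.+2 => ax (std_frame R a)).
  by apply/projective_frameP; [exact: std_frame_neq0|exact: std_frame_is_frame].
congr (projective_frame _); apply/funext => a; exact: glue_head.
Qed.

Definition std_ad (y : {ptws 'I_q -> RP R m}) : Gkm R hk :=
  exist _ (glue (fun a => ax (std_frame R a)) y : {ptws 'I_k -> RP R m}) (mem_set (std_Gkm y)).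

Lemma std_ad_head y a : val (std_ad y) (head a) = ax (std_frame R a).
Proof. exact: glue_head. Qed.

Lemma std_ad_tail y j : val (std_ad y) (tail j) = y j.
Proof. exact: glue_tail. Qed.

Lemma shape_ofP (p p' : Gkm R hk) : shape_of R hk p = shape_of R hk p' <->
  exists2 al, PGL al & forall i, val p' i = al (val p i).
Proof.
split=> [e|h].
  by have /eqmodP/asboolP : p = p' %[mod {eq_quot (@same_shape R m k hk)}] := e.
by apply: (eqmodP (@same_shape_equiv_rel R m k hk) p p' _); apply/asboolP.
Qed.

Lemma shape_std_inj : injective (shape_of R hk \o std_ad).
Proof.
move=> y y' /shape_ofP[al /PGL_mx[A uA alE] e].
have [a|l l0 Al] := @fixes_std_frame _ _ A uA.
  by rewrite -alE ?std_frame_neq0// -(std_ad_head y) -e !std_ad_head.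
apply/funext => j; have := e (tail j); rewrite !std_ad_tail => ->.
have [Y Y0 ->] := ax_surj (y j).
by rewrite alE// Al mul_scalar_mx axZ.
Qed.

Lemma std_ad_shape (p : Gkm R hk) (y : {ptws 'I_q -> RP R m}) A : A \in unitmx ->
  (forall a, val p (head a) = ax (A *m std_frame R a)) ->
  (forall j Y, Y != 0 -> y j = ax Y -> val p (tail j) = ax (A *m Y)) ->
  shape_of R hk p = shape_of R hk (std_ad y).
Proof.
move=> uA ph pt; apply/esym/shape_ofP; have [al Pal alE] := mx_PGL uA.
exists al => // i; case: (head_tail i) => -[j ->].
  by rewrite ph std_ad_head alE// std_frame_neq0.
rewrite std_ad_tail; have [Y Y0 yj] := ax_surj (y j).
by rewrite (pt j Y)// yj alE.
Qed.

(** The matrix of [frame_coordP] moves the normal form to [p]. It is part of the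
    conclusion because the local sections of the quotient map apply it to other k-ads. *)
Lemma shape_coordP (p : Gkm R hk) X : (forall i, X i != 0) -> val p = pts X ->
  [/\ forall j, shape_coord X j != 0,
      shape_of R hk p = shape_of R hk (std_ad (pts (shape_coord X))) &
      exists A, [/\ A \in unitmx,
        forall a, ax (A *m std_frame R a) = val p (head a) &
        forall j, ax (A *m shape_coord X j) = val p (tail j)]].
Proof.
move=> X0 pX; have frX : is_frame (X \o head).
  by apply/Gkm_frame => //; rewrite -pX; exact: set_valP.
have sc0 j : shape_coord X j != 0 by exact: frame_coord_neq0.
have [A [uA Ah At]] := frame_coordP frX; split=> //.
  apply: (std_ad_shape uA) => [a|j Y Y0]; first by rewrite pX Ah.
  move=> /(axP (sc0 j) Y0)[l l0 ->].
  by rewrite -scalemxAr axZ// At pX.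
by exists A; split=> // [a|j]; rewrite pX; [exact: Ah|exact: At].
Qed.

Lemma smooth_shape_coord (V : normedModType R) (X : V -> 'I_k -> 'cV[R]_m.+1) :
  (forall i l, smooth_on setT (fun x => X x i l 0 : R)) ->
  forall j l, smooth_on setT (fun x => shape_coord (X x) j l 0 : R).
Proof.
move=> sX j l.
have sB i i' : smooth_on setT
    (fun x => cols ((X x \o head) \o lift ord_max) i i' : R).
  by move=> n; under eq_fun do rewrite mxE; exact: sX.
have sv (i : 'I_k) l' (z : 'I_1) : smooth_on setT (fun x => X x i l' z : R).
  by rewrite [z]ord1; exact: sX.
have sN (i : 'I_k) l' : smooth_on setT (fun x =>
    (\adj (cols ((X x \o head) \o lift ord_max)) *m X x i) l' 0 : R).
  apply: smooth_mulmx; [exact: openT| |exact: sv].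
  by apply: smooth_adj; [exact: openT|exact: sB].
move=> n; under eq_fun do rewrite mxE.
apply: CkM; [exact: openT|exact: sN|].
by apply: smooth_prod => [|i _]; [exact: openT|exact: sN].
Qed.

(** The representatives chosen by [repr] do not matter, by [shape_pts_of]. *)
Definition shape_pts (s : shape_space R hk) : {ptws 'I_q -> RP R m} :=
  let X (i : 'I_k) := val (repr (val (repr s : Gkm R hk) i) : @nzvec R m) in
  pts (shape_coord X).

Definition shape_std (y : {ptws 'I_q -> RP R m}) : shape_space R hk :=
  shape_of R hk (std_ad y).

Lemma shape_ptsK : cancel shape_pts shape_std.
Proof.
move=> s; set p : Gkm R hk := repr s; rewrite -[RHS](reprK s).
pose X (i : 'I_k) := val (repr (val p i) : @nzvec R m).
have pX : val p = pts X.
  by apply/funext => i; rewrite /pts /X ax_val /axis reprK.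
by have [_ e _] := @shape_coordP p X (fun=> nzvecP _) pX; exact: esym e.
Qed.

Lemma shape_stdK : cancel shape_std shape_pts.
Proof. by move=> y; apply: shape_std_inj; rewrite /= [LHS]shape_ptsK. Qed.

(** For any representatives [X] the right-hand side is the normal form of [p], and normal forms
    are unique. *)
Lemma shape_pts_of (p : Gkm R hk) X : (forall i, X i != 0) -> val p = pts X ->
  shape_pts (shape_of R hk p) = pts (shape_coord X).
Proof. by move=> X0 pX; have [_ -> _] := shape_coordP X0 pX; exact: shape_stdK. Qed.

Lemma std_ad_continuous : continuous std_ad.
Proof.
suff c : continuous (fun y => val (std_ad y) : {ptws 'I_k -> RP R m}).
  move=> y U [_ [[W oW <-] /= Wy WU]].
  have : nbhs y ((fun y => val (std_ad y)) @^-1` W).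
    by apply: (c y); exact: open_nbhs_nbhs.
  by apply: filterS => z /WU.
move=> y; apply: ptws_continuous_at => i; case: (head_tail i) => -[j ->].
  rewrite (_ : (fun y => _) = fun=> ax (std_frame R j)); first exact: cst_continuous.
  by apply/funext => z; exact: std_ad_head.
rewrite (_ : (fun y => _) = fun y : {ptws 'I_q -> RP R m} => y j).
  exact: ptws_eval_continuous.
by apply/funext => z; exact: std_ad_tail.
Qed.

Lemma shape_std_continuous : continuous shape_std.
Proof.
move=> y; apply: (@continuous_comp _ _ _ std_ad (shape_of R hk)).
  exact: std_ad_continuous.
exact: pi_continuous.
Qed.

Definition Gkm_chart a : chart (Gkm R hk) 'M[R]_(k, m) :=
  sub_chart (Gkm R hk) (RPn_chart R a).

Lemma Gkm_chartK a (p : Gkm R hk) : cdom (Gkm_chart a) p ->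
  val p = pts (homs a (Gkm_chart a p)).
Proof. by move=> pa; rewrite [RHS](RPn_chartK pa). Qed.

Lemma shape_pts_chart a (p : Gkm R hk) : cdom (Gkm_chart a) p ->
  shape_pts (shape_of R hk p) = pts (shape_coord (homs a (Gkm_chart a p))).
Proof.
by move=> pa; apply: shape_pts_of; [move=> i; exact: homs_neq0|exact: Gkm_chartK].
Qed.

Lemma shape_coord_homs_neq0 a (p : Gkm R hk) j : cdom (Gkm_chart a) p ->
  shape_coord (homs a (Gkm_chart a p)) j != 0.
Proof.
move=> pa.
by have [] := shape_coordP (fun i => homs_neq0 a _ i) (Gkm_chartK pa).
Qed.

(** In a chart around a k-ad the invariant is given by polynomial homogeneous coordinates of
    representatives that depend continuously on the k-ad. *)
Lemma shape_pts_continuous : continuous shape_pts.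
Proof.
apply/quotient_continuous => p; have [a pa] := RPn_chart_cover (val p).
have cc : {for p, continuous (Gkm_chart a)}.
  apply: continuous_comp; first exact: initial_continuous.
  exact: RPn_chart_continuous.
have np : nbhs p (cdom (Gkm_chart a)).
  apply: open_nbhs_nbhs; split=> //; exists (cdom (RPn_chart R a)) => //.
  exact: RPn_chart_open.
apply: (@near_eq_continuous_at _ _
  (fun p => pts (shape_coord (homs a (Gkm_chart a p))))).
  by apply: filterS np => p' pa'; rewrite /= -shape_pts_chart.
apply: (@continuous_comp _ _ _ (Gkm_chart a)
  (fun N => pts (shape_coord (homs a N)))); first exact: cc.
apply: pts_continuous_at => j; first exact: shape_coord_homs_neq0.
exact: (smooth_coord_continuous (smooth_shape_coord (smooth_homs R a))).

Qed.

(** * The quotient map is a submersion *)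

Lemma shape_smooth_rep a b : exists g,
  smooth_rep (Gkm_chart a) (pull_chart shape_pts (RPn_chart R b)) (shape_of R hk) g.
Proof.
exists (fun N => coord_mx b (shape_coord (homs a N))); split=> [n|p pa pb].
  apply: Ck_subset (smooth_coord_mx (smooth_shape_coord (smooth_homs R a)) b n).
  move=> _ [p [pa pb] <-] /=.
  apply/RPn_chart_dom; first by move=> j; exact: shape_coord_homs_neq0.
  by rewrite -shape_pts_chart.
rewrite -(RPn_chart_pts b) => [|j]; last exact: shape_coord_homs_neq0.
by rewrite -(shape_pts_chart pa).
Qed.

(** Let A be the matrix that moves the normal form of [p] to [p]. The section keeps the frame
    of [p] and sends an invariant y to the k-ad whose further points are the images A y_j:
    its shape is that of [std_ad y], and at the invariant of [p] it returns [p]. *)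
Lemma shape_local_section a b (p : Gkm R hk) : cdom (Gkm_chart a) p ->
  cdom (RPn_chart R b) (shape_pts (shape_of R hk p)) ->
  let N0 := RPn_chart R b (shape_pts (shape_of R hk p)) in
  exists s : 'M[R]_(q, m) -> 'M[R]_(k, m),
    [/\ differentiable s N0, s N0 = Gkm_chart a p &
      \forall N \near N0, exists p' : Gkm R hk,
        [/\ cdom (Gkm_chart a) p', Gkm_chart a p' = s N &
            shape_pts (shape_of R hk p') = pts (homs b N)]].
Proof.
move=> pa pb N0; pose X := homs a (Gkm_chart a p).
have X0 i : X i != 0 by exact: homs_neq0.
have pX : val p = pts X := Gkm_chartK pa.
have [sc0 _ [A [uA Ah At]]] := shape_coordP X0 pX.
pose Z N := glue (X \o head) (fun j => A *m homs b N j).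
have Z0 N i : Z N i != 0.
  case: (head_tail i) => -[j ->]; first by rewrite /Z glue_head; exact: X0.
  by rewrite /Z glue_tail mulmx_unit_neq0// homs_neq0.
have sZ i l : smooth_on setT (fun N => Z N i l 0 : R).
  case: (head_tail i) => -[j ->] n.
    rewrite (_ : (fun N => _) = fun=> X (head j) l 0); first exact: Ck_cst.
    by apply/funext => N; rewrite /Z glue_head.
  rewrite (_ : (fun N => _) = fun N => (A *m homs b N j) l 0); last first.
    by apply/funext => N; rewrite /Z glue_tail.
  apply: smooth_mulmx; [exact: openT|by move=> ? ? ?; exact: Ck_cst|].
  by move=> i' z; rewrite [z]ord1; exact: smooth_homs.
have GZ N : Gkm R hk (pts (Z N)).
  apply/Gkm_frame => //; rewrite (_ : _ \o _ = X \o head).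
    by apply/Gkm_frame => //; rewrite -pX; exact: set_valP.
  by apply/funext => c; rewrite /= /Z glue_head.
pose pZ N : Gkm R hk := exist _ (pts (Z N)) (mem_set (GZ N)).
have ZN0 : pts (Z N0) = val p.
  apply/funext => i; case: (head_tail i) => -[j ->].
    by rewrite /pts /Z glue_head pX.
  rewrite /pts /Z glue_tail -At.
  have : ax (shape_coord X j) = ax (homs b N0 j).
    have := RPn_chartK pb; rewrite -/N0 (shape_pts_of X0 pX).
    by move/(congr1 (fun y => y j)).
  by move/(axP (sc0 j) (homs_neq0 _ _ _)) => [l l0 ->]; rewrite -scalemxAr axZ.
have UN0 : (forall i, Z N0 i (a i) 0 != 0).
  by apply/RPn_chart_dom => //; rewrite ZN0.
exists (fun N => coord_mx a (Z N)); split.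
- by have [h _] := smooth_coord_mx sZ a 1; exact: h.
- by rewrite -RPn_chart_pts// ZN0.
- have := open_nbhs_nbhs (conj (open_coord_dom sZ a) UN0).
  apply: filterS => N UN; exists (pZ N); split.
  + exact/RPn_chart_dom.
  + exact: RPn_chart_pts.
  + rewrite (_ : shape_of R hk (pZ N) = shape_std (pts (homs b N))).
      exact: shape_stdK.
    apply: (std_ad_shape uA) => [c|j Y Y0 e].
      by rewrite Ah pX /= /pts /Z glue_head.
    rewrite /= /pts /Z glue_tail.
    by move: e => /(axP (homs_neq0 _ _ _) Y0)[l l0 ->]; rewrite -scalemxAr axZ.
Qed.

(** The quotient map composed with a local section is the identity near the given point, so
    by the chain rule the differential of the section provides the preimages. *)
Lemma shape_submersion : submersion (G_atlas R hk)
  (pull_atlas shape_pts (power_atlas q (RP_atlas R m))) (shape_of R hk).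
Proof.
split; first split.
- exact: pi_continuous.
- move=> _ _ [c /RPn_atlasP[a ->] <-] [d /RPn_atlasP[b ->] <-].
  exact: shape_smooth_rep.
move=> _ _ g [c /RPn_atlasP[a ->] <-] [d /RPn_atlasP[b ->] <-] [sg ge] p pa pb w.
have [s [ds sN0 sN]] := shape_local_section pa pb.
set N0 := RPn_chart R b _ in ds sN0 sN.
have dg : differentiable g (s N0).
  by have [h _] := sg 1; rewrite sN0; apply: h; exists p.
have gs : \forall N \near N0, (g \o s) N = idfun N.
  apply: filterS sN => N [p' [pa' sp' e]]; rewrite /= -sp'.
  transitivity (RPn_chart R b (pts (homs b N))); last exact: homs_chartK.
  by rewrite -e; apply: ge => //=; rewrite e; exact: homs_dom.
have [_ dgs] := near_eq_diff gs (differentiable_comp ds dg).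
have did : 'd (idfun : 'M[R]_(q, m) -> 'M[R]_(q, m)) N0 = idfun :> (_ -> _).
  by apply: diff_lin => N; exact: cvg_id.
exists ('d s N0 w); rewrite -sN0.
transitivity ('d (g \o s) N0 w).
  exact: esym (congr1 (fun h : 'M[R]_(q, m) -> 'M[R]_(q, m) => h w) (diff_comp ds dg)).
by rewrite -dgs did.
Qed.

End Shapes.

(** * The projective shape space *)
Theorem proposition2p3 (R : realType) (m k : nat) (hk : (m.+2 < k)%N) :
  exists A : atlas (shape_space R hk) 'M[R]_(k - m - 2, m),
    [/\ smooth_atlas A,
        submersion (G_atlas R hk) A (shape_of R hk)
      & diffeomorphic A (power_atlas (k - m - 2) (RP_atlas R m))].
Proof.
exists (pull_atlas (@shape_pts R m k hk) (power_atlas (k - m - 2) (RP_atlas R m))).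
have sB := @RPn_smooth_atlas R m (k - m - 2); have hc := @shape_pts_continuous R m k hk.
have h'c := @shape_std_continuous R m k hk; split.
- exact: pull_atlas_smooth hc h'c (@shape_ptsK _ _ _ _) (@shape_stdK _ _ _ _) sB.
- exact: shape_submersion.
- exact: pull_atlas_diffeomorphic hc h'c (@shape_ptsK _ _ _ _) (@shape_stdK _ _ _ _) sB.
Qed.
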